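(* Let $b^*$ be the generalized Nash equilibrium of the improved sharing game described in the context, $p^*$ the corresponding optimal adjustment, $\Pi_i(p_i^*,b^* )$ the cost of prosumer $i$ at this equilibrium, and $f_i(D_i)$ the cost of prosumer $i$ under individual decision-making. Then $$\Pi_i(p_i^*,b^* )\le f_i(D_i)\qquad\text{for all } i\in\mathcal{I}.$$
   Context: Setting. There are $I\ge 2$ prosumers $i\in\mathcal{I}=\{1,\dots,I\}$, each owning $K$ resources $k\in\{1,\dots,K\}$. Prosumer $i$ has a required adjustment $D_i\in\mathbb{R}$; resource $k$ of prosumer $i$ has a cost coefficient $c_i^k>0$; $a>0$ is a constant. The prosumers sit at buses of a network (simple undirected graph) with lines $l\in\mathcal{L}=\{1,\dots,L\}$ and flow limits $F_l>0$. $\pi_{il}$ is the line flow distribution factor from the bus of prosumer $i$ to line $l$ in the DC power flow model: for a balanced vector of energy transactions $q$ ($\sum_i q_i=0$), the flow on line $l$ is $\sum_i\pi_{il}q_i$. Market clearing. Given bids $b=(b_1,\dots,b_I)\in\mathbb{R}^I$, the prices $\lambda(b)=(\lambda_1(b),\dots,\lambda_I(b))$ are the (unique) solution of $$\min_{\lambda\in\mathbb{R}^I}\ \frac1I\sum_i\lambda_i^2\quad\text{s.t.}\quad \sum_i(-a\lambda_i+b_i)=0,\quad -F_l\le\sum_i\pi_{il}(-a\lambda_i+b_i)\le F_l\ \ \forall l.$$ The transaction of prosumer $i$ is $q_i(b)=-a\lambda_i(b)+b_i$. Improved sharing game. For $p_i=(p_i^1,\dots,p_i^K)\in\mathbb{R}^K$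 put $md_i=md_i(p_i):=\dfrac{2\sum_k p_i^k}{\sum_k 1/c_i^k}$. Given the other bids $b_{-i}$, prosumer $i$ chooses $p_i\in\mathbb{R}^K$ and $b_i\in\mathbb{R}$ to minimize the cost $$\sum_k c_i^k(p_i^k)^2+\max\left\{\lambda_i(b)q_i(b),\ \Big(md_i(p_i)-\frac{q_i(b)}{a(I-1)}\Big)q_i(b)\right\}\quad\text{s.t.}\quad \sum_k p_i^k+q_i(b)=D_i.$$ The value of this objective is the cost $\Pi_i(p_i,b)$ of prosumer $i$ in this game. A bid profile $b^*$, with corresponding optimal adjustment $p^*$ (for each $i$, $p_i^*$ minimizes the cost over $p_i$ at the bids $b^*$ subject to the constraint), is a generalized Nash equilibrium (GNE) if for every $i$, $(p_i^*,b_i^* )$ is an optimal solution of prosumer $i$'s problem given $b_{-i}^*$. Individual decision-making. Without sharing, prosumer $i$ must satisfy $\sum_k p_i^k=D_i$ by itself, with minimal cost $$f_i(D_i)=\min\Big\{\sum_k c_i^k(p_i^k)^2:\ \sum_k p_i^k=D_i\Big\}=\frac{D_i^2}{\sum_k 1/c_i^k}.$$ *)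

(* Defs.v *)
(* MathComp / MathComp-Analysis; the reals are an arbitrary [R : realType]. *)
From HB Require Import structures.
From mathcomp Require Import all_boot all_order all_algebra.
From mathcomp Require Import all_classical all_reals all_analysis.

Set Implicit Arguments.
Unset Strict Implicit.
Unset Printing Implicit Defensive.

Import Order.TTheory GRing.Theory Num.Theory.
Import numFieldNormedType.Exports.

Local Open Scope classical_set_scope.
Local Open Scope ring_scope.

(* The undirected line [l] joins [src l] and [dst l]; the order of the two ends
   only fixes the direction in which its flow is counted positively. *)
Definition simple_network (B : finType) (L : nat) (src dst : 'I_L -> B) : Prop :=
  (forall l, src l != dst l) /\
  injective (fun l => [set src l; dst l]%SET).

(* DC power flow: [theta] are the voltage angles, [beta] the line
   susceptances and [inj] the net power injections at the buses. *)
Definition dc_power_flow (R : realType) (B : finType) (L : nat)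
    (src dst : 'I_L -> B) (beta : 'I_L -> R) (inj : B -> R)
    (flow : 'I_L -> R) : Prop :=
  exists theta : B -> R,
    (forall l, flow l = beta l * (theta (src l) - theta (dst l))) /\
    (forall n, inj n = \sum_(l | src l == n) flow l
                       - \sum_(l | dst l == n) flow l).

(* Distribution factors depend on the choice of a reference bus; changing it
   adds to each [ptdf ^~ l] a constant, which is immaterial on balanced [q].
   Hence they are specified by the flows they give for balanced [q]. *)
Definition is_ptdf (R : realType) (B : finType) (I L : nat)
    (src dst : 'I_L -> B) (beta : 'I_L -> R) (bus : 'I_I -> B)
    (ptdf : 'I_I -> 'I_L -> R) : Prop :=
  forall q : 'rV[R]_I, \sum_i q ord0 i = 0 ->
    dc_power_flow src dst beta (fun n => \sum_(i | bus i == n) q ord0 i)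
      (fun l => \sum_i ptdf i l * q ord0 i).

Definition market_feasible (R : realType) (I L : nat) (a : R)
    (ptdf : 'I_I -> 'I_L -> R) (F : 'I_L -> R) (b lam : 'rV[R]_I) : Prop :=
  \sum_i (- a * lam ord0 i + b ord0 i) = 0 /\
  (forall l, - F l <= \sum_i ptdf i l * (- a * lam ord0 i + b ord0 i) <= F l).

Definition market_objective (R : realType) (I : nat) (lam : 'rV[R]_I) : R :=
  I%:R^-1 * \sum_i lam ord0 i ^+ 2.

Definition market_solution (R : realType) (I L : nat) (a : R)
    (ptdf : 'I_I -> 'I_L -> R) (F : 'I_L -> R) (b lam : 'rV[R]_I) : Prop :=
  market_feasible a ptdf F b lam /\
  (forall mu, market_feasible a ptdf F b mu ->
     market_objective lam <= market_objective mu).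

(* For [a > 0] and [F > 0] the feasible set is closed, convex and contains
   [a^-1 *: b], and the objective (for [0 < I]) is coercive and strictly
   convex: there is exactly one solution, and the default [0] is not used. *)
Definition price (R : realType) (I L : nat) (a : R)
    (ptdf : 'I_I -> 'I_L -> R) (F : 'I_L -> R) (b : 'rV[R]_I) : 'rV[R]_I :=
  xget 0 [set lam | market_solution a ptdf F b lam].

Definition transaction (R : realType) (I L : nat) (a : R)
    (ptdf : 'I_I -> 'I_L -> R) (F : 'I_L -> R) (b : 'rV[R]_I) (i : 'I_I) : R :=
  - a * price a ptdf F b ord0 i + b ord0 i.

Definition adjustment_cost (R : realType) (K : nat) (c : 'I_K -> R)
    (p : 'rV[R]_K) : R :=
  \sum_k c k * p ord0 k ^+ 2.

Definition marginal_disutility (R : realType) (K : nat) (c : 'I_K -> R)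
    (p : 'rV[R]_K) : R :=
  2 * (\sum_k p ord0 k) / (\sum_k (c k)^-1).

Definition prosumer_cost (R : realType) (I K L : nat) (a : R)
    (c : 'I_I -> 'I_K -> R) (ptdf : 'I_I -> 'I_L -> R) (F : 'I_L -> R)
    (i : 'I_I) (pi : 'rV[R]_K) (b : 'rV[R]_I) : R :=
  let q := transaction a ptdf F b i in
  adjustment_cost (c i) pi +
  Num.max (price a ptdf F b ord0 i * q)
          ((marginal_disutility (c i) pi - q / (a * (I%:R - 1))) * q).

Definition prosumer_feasible (R : realType) (I K L : nat) (a : R)
    (D : 'I_I -> R) (ptdf : 'I_I -> 'I_L -> R) (F : 'I_L -> R)
    (i : 'I_I) (pi : 'rV[R]_K) (b : 'rV[R]_I) : Prop :=
  \sum_k pi ord0 k + transaction a ptdf F b i = D i.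

(* The bid profile [(x, b_{-i})]. *)
Definition set_bid (R : realType) (I : nat) (b : 'rV[R]_I) (i : 'I_I) (x : R) :
    'rV[R]_I :=
  \row_j (if j == i then x else b ord0 j).

Definition optimal_adjustment (R : realType) (I K L : nat) (a : R)
    (c : 'I_I -> 'I_K -> R) (D : 'I_I -> R)
    (ptdf : 'I_I -> 'I_L -> R) (F : 'I_L -> R)
    (b : 'rV[R]_I) (p : 'I_I -> 'rV[R]_K) : Prop :=
  forall i,
    prosumer_feasible a D ptdf F i (p i) b /\
    (forall pi' : 'rV[R]_K, prosumer_feasible a D ptdf F i pi' b ->
       prosumer_cost a c ptdf F i (p i) b
       <= prosumer_cost a c ptdf F i pi' b).

Definition prosumer_optimal (R : realType) (I K L : nat) (a : R)
    (c : 'I_I -> 'I_K -> R) (D : 'I_I -> R)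
    (ptdf : 'I_I -> 'I_L -> R) (F : 'I_L -> R)
    (i : 'I_I) (pi : 'rV[R]_K) (b : 'rV[R]_I) : Prop :=
  prosumer_feasible a D ptdf F i pi b /\
  (forall (pi' : 'rV[R]_K) (x : R),
     prosumer_feasible a D ptdf F i pi' (set_bid b i x) ->
     prosumer_cost a c ptdf F i pi b
     <= prosumer_cost a c ptdf F i pi' (set_bid b i x)).

Definition is_GNE (R : realType) (I K L : nat) (a : R)
    (c : 'I_I -> 'I_K -> R) (D : 'I_I -> R)
    (ptdf : 'I_I -> 'I_L -> R) (F : 'I_L -> R)
    (b : 'rV[R]_I) (p : 'I_I -> 'rV[R]_K) : Prop :=
  optimal_adjustment a c D ptdf F b p /\
  (forall i, prosumer_optimal a c D ptdf F i (p i) b).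

(* [inf] in [R]; for [0 < K] and [c > 0] the infimum is attained. *)
Definition individual_cost (R : realType) (K : nat) (c : 'I_K -> R) (d : R) : R :=
  inf [set adjustment_cost c p | p in [set p : 'rV[R]_K | \sum_k p ord0 k = d]].

(* Main.v *)
Require Import Defs.
From HB Require Import structures.
From mathcomp Require Import all_boot all_order all_algebra.
From mathcomp Require Import all_classical all_reals all_analysis.
From mathcomp Require Import ring lra.

(** A prosumer never does worse by sharing because it can always bid itself out
    of the market.  If some bid [x], given the other bids, makes its transaction
    vanish, then both arguments of the maximum in its cost are zero, and every
    [p] with [\sum_k p k = D i] becomes feasible at its bare adjustment cost.
    Optimality of the equilibrium then bounds the equilibrium cost by each of
    these adjustment costs, hence by their infimum.

    What has to be proved is that such a bid exists ([can_bid_out]).  Since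
    [lambda = (b - q) / a], clearing the market means minimizing [|b - q|^2]:
    the transactions are the Euclidean projection of the bids onto the convex
    polyhedron of balanced transactions that respect the flow limits
    ([transaction_obtuse], with the projection recognized by the obtuse angle
    [(b - q) . (v - q) <= 0] at every [v] of the polyhedron).  Project [b] onto
    the slice [q i = 0] of the polyhedron to get [q].  Changing only the [i]-th
    bid adds a multiple of [v i] to [(b - q) . (v - q)], and a suitable
    multiple, which is the Lagrange multiplier of the constraint [q i = 0],
    extends the obtuse angle from the slice to the whole polyhedron
    ([zero_coordinate_multiplier]).  The multiplier exists because the
    polyhedron contains points on both sides of the slice
    ([tradable_both_signs]): flow limits are positive, so small trades in both
    directions with another prosumer are possible. *)

Set Implicit Arguments.
Unset Strict Implicit.
Unset Printing Implicit Defensive.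

Import Order.TTheory GRing.Theory Num.Theory.
Import numFieldNormedType.Exports.

Local Open Scope classical_set_scope.
Local Open Scope ring_scope.

(** * Projection onto a closed convex set *)

Definition dot (R : realType) (n : nat) (u v : 'rV[R]_n) : R :=
  \sum_j u ord0 j * v ord0 j.

Definition segment_closed (R : realType) (n : nat) (C : set 'rV[R]_n) : Prop :=
  forall (u v : 'rV[R]_n) (t : R),
    0 <= t <= 1 -> C u -> C v -> C (t *: u + (1 - t) *: v).

Lemma dotC (R : realType) n (u v : 'rV[R]_n) : dot u v = dot v u.
Proof. by apply: eq_bigr => j _; rewrite mulrC. Qed.

Lemma dotDr (R : realType) n (u v w : 'rV[R]_n) :
  dot u (v + w) = dot u v + dot u w.
Proof. by rewrite -big_split; apply: eq_bigr => j _; rewrite mxE mulrDr. Qed.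

Lemma dotZr (R : realType) n (u v : 'rV[R]_n) (t : R) :
  dot u (t *: v) = t * dot u v.
Proof. by rewrite mulr_sumr; apply: eq_bigr => j _; rewrite mxE mulrCA. Qed.

Lemma dotZl (R : realType) n (u v : 'rV[R]_n) (t : R) :
  dot (t *: u) v = t * dot u v.
Proof. by rewrite dotC dotZr dotC. Qed.

Lemma dot_sqrD (R : realType) n (u v : 'rV[R]_n) :
  dot (u + v) (u + v) = dot u u + 2 * dot u v + dot v v.
Proof. by rewrite dotDr !(dotC (u + v)) !dotDr (dotC v u); ring. Qed.

Lemma dot_ge0 (R : realType) n (u : 'rV[R]_n) : 0 <= dot u u.
Proof. by apply: sumr_ge0 => j _; rewrite -expr2 sqr_ge0. Qed.

Lemma dot_le0_eq0 (R : realType) n (u : 'rV[R]_n) : dot u u <= 0 -> u = 0.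
Proof.
move=> u_le0.
have /psumr_eq0P u0 : dot u u = 0 by apply/eqP; rewrite eq_le u_le0 dot_ge0.
apply/rowP => j; rewrite mxE; apply/eqP; rewrite -sqrf_eq0 expr2.
by apply/eqP/u0 => // k _; rewrite -expr2 sqr_ge0.
Qed.

Lemma continuous_linear_form (R : realType) n (u : 'rV[R]_n) :
  continuous (dot u).
Proof.
apply: continuous_big; first exact: add_continuous.
move=> j _ v.
apply: (@continuousM _ _ (fun=> u ord0 j) (fun w : 'rV[R]_n => w ord0 j)).
  exact: cst_continuous.
exact: coord_continuous.
Qed.

Lemma continuous_sqdist (R : realType) n (b : 'rV[R]_n) :
  continuous (fun v : 'rV[R]_n => dot (b - v) (b - v)).
Proof.
have -> : (fun v : 'rV[R]_n => dot (b - v) (b - v)) =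
          (fun v : 'rV[R]_n => \sum_j (b ord0 j - v ord0 j) * (b ord0 j - v ord0 j)).
  by apply/funext => v; apply: eq_bigr => j _; rewrite !mxE.
apply: continuous_big; first exact: add_continuous.
move=> j _ v.
pose f (w : 'rV[R]_n) : R := b ord0 j - w ord0 j.
have f_cont : {for v, continuous f}.
  by apply: continuousB; [exact: cst_continuous | exact: coord_continuous].
exact: (continuousM f_cont f_cont).
Qed.

(** Points farther from [b] than some given [c] of [C] do not compete, and the
    others lie in a box, so compactness applies to unbounded [C] as well; the
    set of feasible transactions can indeed be unbounded, for instance when
    prosumers share a bus. *)
Lemma closest_point_exists (R : realType) n (C : set 'rV[R]_n) (b : 'rV[R]_n) :
  closed C -> C !=set0 ->
  exists2 q, C q &
    forall v, C v -> dot (b - q) (b - q) <= dot (b - v) (b - v).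
Proof.
move=> Ccl [c Cc]; set M := dot (b - c) (b - c).
pose S := C `&` [set v | dot (b - v) (b - v) <= M].
have Scl : closed S.
  apply: closedI => //.
  apply: (proj1 (continuous_closedP _) (@continuous_sqdist R n b)
            [set x | x <= M]).
  exact: closed_le.
have Scpt : compact S.
  apply: (@subclosed_compact _ S _ Scl) (rV_compact _) _.
    by move=> j; exact: (@segment_compact _ (b ord0 j - (1 + M))
                                            (b ord0 j + (1 + M))).
  move=> v [_ /= vM] j /=.
  have : (b ord0 j - v ord0 j) ^+ 2 <= M.
    apply: le_trans vM; rewrite /dot (bigD1 j) //= !mxE -expr2 lerDl.
    by apply: sumr_ge0 => k _; rewrite -expr2 sqr_ge0.
  (* [|d| <= 1 + M] follows from [2 |d| <= 1 + d ^+ 2 <= 1 + M]. *)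
  rewrite in_itv /= => d_le; set d := b ord0 j - v ord0 j in d_le.
  have d_sq := sqr_ge0 d; have d1 := sqr_ge0 (d - 1); have d2 := sqr_ge0 (d + 1).
  by rewrite /d in d_le d_sq d1 d2 *; apply/andP; split; lra.
have S0 : S !=set0 by exists c; split => //=.
have [|q /set_mem [Cq qM] qmin] := EVT_min_rV S0 Scpt
  (f := fun v => dot (b - v) (b - v)).
  exact/continuous_subspaceT/continuous_sqdist.
exists q => // v Cv; have [vM|/ltW Mv] := leP (dot (b - v) (b - v)) M.
  by apply: qmin; apply/mem_set.
exact: le_trans Mv.
Qed.

(** Moving from [q] towards [v] by a small step would come closer to [b] if the
    angle at [q] were acute. *)
Lemma closest_point_obtuse (R : realType) n (C : set 'rV[R]_n)
    (b q : 'rV[R]_n) :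
  segment_closed C -> C q ->
  (forall v, C v -> dot (b - q) (b - q) <= dot (b - v) (b - v)) ->
  forall v, C v -> dot (b - q) (v - q) <= 0.
Proof.
move=> Cconv Cq qmin v Cv; rewrite leNgt; apply/negP => g_gt0.
set g := dot _ _ in g_gt0; have d_ge0 := dot_ge0 (v - q).
set d := dot _ _ in d_ge0.
have gd_gt0 : 0 < g + d by lra.
(* A step [t] changes the squared distance by [- 2 t g + t ^+ 2 d]; this [t]
   makes it negative and is at most 1 whatever the size of [d]. *)
pose t := g / (g + d).
have t01 : 0 <= t <= 1.
  by rewrite /t divr_ge0 ?(ltW g_gt0) ?(ltW gd_gt0) // ler_pdivrMr // mul1r lerDl.
have t_gt0 : 0 < t by rewrite divr_gt0.
have := qmin _ (Cconv v q t t01 Cv Cq).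
have -> : b - (t *: v + (1 - t) *: q) = (b - q) + (- t) *: (v - q).
  by apply/rowP => j; rewrite !mxE; ring.
rewrite [leRHS]dot_sqrD !dotZr dotZl -/g -/d.
have td : t * d = g - t * g.
  by have : t * (g + d) = g; [rewrite divfK ?gt_eqF | lra].
have tg_gt0 : 0 < t * g by rewrite mulr_gt0.
rewrite [- t * (- t * d)]mulrA mulrNN -mulrA td; nra.
Qed.

(** The converse of [closest_point_obtuse] in a quantitative form: the extra
    term [dot (v - q) (v - q)] gives uniqueness of the closest point. *)
Lemma obtuse_sqdist (R : realType) n (b q v : 'rV[R]_n) :
  dot (b - q) (v - q) <= 0 ->
  dot (b - q) (b - q) + dot (v - q) (v - q) <= dot (b - v) (b - v).
Proof.
move=> obt; have -> : b - v = (b - q) + (-1) *: (v - q).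
  by apply/rowP => j; rewrite !mxE; ring.
rewrite [leRHS]dot_sqrD !dotZr dotZl; lra.
Qed.

(** * Steering one coordinate of the projection to zero *)

Lemma dot_set_bid (R : realType) n (b q v : 'rV[R]_n) (i : 'I_n) (x : R) :
  dot (set_bid b i x - q) (v - q) =
  dot (b - q) (v - q) + (x - b ord0 i) * (v ord0 i - q ord0 i).
Proof.
rewrite /dot (bigD1 i) // [in RHS](bigD1 i) //= !mxE eqxx.
rewrite (eq_bigr (fun j => (b - q) ord0 j * (v - q) ord0 j)); first by ring.
by move=> j /negPf ji; rewrite !mxE ji.
Qed.

(** With [g v = (b - q) . (v - q)], one needs a number [m] such that
    [g v + m * v i <= 0] on [C].  Points with [v i < 0] bound [m] from below,
    those with [v i > 0] from above, and the two families of bounds are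
    compatible since the segment between two such points crosses the slice
    [u i = 0], where the affine function [g] is nonpositive.  The supremum of
    the lower bounds is therefore suitable; it is finite because both families
    are nonempty. *)
Lemma zero_coordinate_multiplier (R : realType) n (C : set 'rV[R]_n)
    (b q : 'rV[R]_n) (i : 'I_n) :
  segment_closed C ->
  (exists2 v, C v & 0 < v ord0 i) -> (exists2 w, C w & w ord0 i < 0) ->
  q ord0 i = 0 ->
  (forall u, C u -> u ord0 i = 0 -> dot (b - q) (u - q) <= 0) ->
  exists x, forall v, C v -> dot (set_bid b i x - q) (v - q) <= 0.
Proof.
move=> Cconv [v0 Cv0 v0_gt0] [w0 Cw0 w0_lt0] qi0 obt.
pose g u := dot (b - q) (u - q).
pose S := [set y | exists w, [/\ C w, w ord0 i < 0 & y = g w / (- w ord0 i)]].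
have cross v w : C v -> C w -> 0 < v ord0 i -> w ord0 i < 0 ->
    g w / (- w ord0 i) <= - g v / v ord0 i.
  move=> Cv Cw v_gt0 w_lt0.
  (* [t] is the parameter at which the segment crosses the slice. *)
  have vw_gt0 : 0 < v ord0 i - w ord0 i by lra.
  pose t := - w ord0 i / (v ord0 i - w ord0 i).
  have t01 : 0 <= t <= 1.
    by rewrite /t divr_ge0 ?ler_pdivrMr //; lra.
  have tE : t * (v ord0 i - w ord0 i) = - w ord0 i by rewrite divfK ?gt_eqF.
  have ui0 : (t *: v + (1 - t) *: w) ord0 i = 0 by rewrite !mxE; lra.
  have := obt _ (Cconv v w t t01 Cv Cw) ui0.
  have -> : t *: v + (1 - t) *: w - q = t *: (v - q) + (1 - t) *: (w - q).
    by apply/rowP => j; rewrite !mxE; ring.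
  rewrite dotDr !dotZr -/(g v) -/(g w) => gu_le0.
  rewrite ler_pdivrMr ?oppr_gt0 // mulrAC ler_pdivlMr //.
  have := mulr_ge0_le0 (ltW vw_gt0) gu_le0; set e := (X in X <= 0).
  have -> : e = (t * (v ord0 i - w ord0 i)) * g v
     + (v ord0 i - w ord0 i - t * (v ord0 i - w ord0 i)) * g w by rewrite /e; ring.
  rewrite tE; lra.
have S0 : S !=set0 by exists (g w0 / (- w0 ord0 i)), w0.
have Sub : has_ubound S.
  by exists (- g v0 / v0 ord0 i) => _ [w [Cw w_lt0 ->]]; exact: cross.
exists (b ord0 i + sup S) => v Cv.
rewrite dot_set_bid qi0 subr0 -/(g v) [_ + sup S]addrC addrK.
have [v_lt0|v_gt0|vi0] := ltgtP (v ord0 i) 0.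
- have : g v / (- v ord0 i) <= sup S by apply: ub_le_sup => //; exists v.
  rewrite ler_pdivrMr ?oppr_gt0 //; lra.
- have : sup S <= - g v / v ord0 i.
    by apply: ge_sup => // _ [w [Cw w_lt0 ->]]; exact: cross.
  rewrite ler_pdivlMr //; lra.
- by rewrite vi0 mulr0 addr0; apply: obt.
Qed.

(** * Market clearing as a projection *)

Definition tradable (R : realType) (I L : nat) (ptdf : 'I_I -> 'I_L -> R)
    (F : 'I_L -> R) : set 'rV[R]_I :=
  [set q | \sum_i q ord0 i = 0 /\
           forall l, - F l <= \sum_i ptdf i l * q ord0 i <= F l].

Lemma tradable_segment_closed (R : realType) (I L : nat)
    (ptdf : 'I_I -> 'I_L -> R) (F : 'I_L -> R) :
  segment_closed (tradable ptdf F).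
Proof.
move=> u v t /andP[t0 t1] [su fu] [sv fv]; split.
  rewrite (eq_bigr (fun j => t * u ord0 j + (1 - t) * v ord0 j)); last first.
    by move=> j _; rewrite !mxE.
  by rewrite big_split -!mulr_sumr /= su sv !mulr0 addr0.
move=> l.
rewrite (eq_bigr (fun j => t * (ptdf j l * u ord0 j)
                         + (1 - t) * (ptdf j l * v ord0 j))); last first.
  by move=> j _; rewrite !mxE; ring.
rewrite big_split -!mulr_sumr /=.
by have /andP[? ?] := fu l; have /andP[? ?] := fv l; apply/andP; split; nra.
Qed.

Lemma tradable_closed (R : realType) (I L : nat)
    (ptdf : 'I_I -> 'I_L -> R) (F : 'I_L -> R) :
  closed (tradable ptdf F).
Proof.
have lin_closed (u : 'rV[R]_I) A : closed A -> closed (dot u @^-1` A).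
  exact: (proj1 (continuous_closedP _) (@continuous_linear_form _ _ u)).
have flowE l (q : 'rV[R]_I) :
    dot (\row_j ptdf j l) q = \sum_j ptdf j l * q ord0 j.
  by apply: eq_bigr => j _; rewrite mxE.
have balanceE (q : 'rV[R]_I) : dot (const_mx 1) q = \sum_j q ord0 j.
  by apply: eq_bigr => j _; rewrite mxE mul1r.
have -> : tradable ptdf F = dot (const_mx 1) @^-1` [set x | x = 0] `&`
    \bigcap_(l in [set: 'I_L]) (dot (\row_j ptdf j l) @^-1` `[- F l, F l]).
  apply/seteqP; split=> q /= -[]; rewrite balanceE => sq fq; split=> // l.
    by move=> _; rewrite /= flowE in_itv /=; exact: fq.
  by have := fq l Logic.I; rewrite /= flowE in_itv.
apply: closedI; first by apply: lin_closed; exact: closed_eq.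
by apply: closed_bigI => l _; apply: lin_closed; exact: itv_closed.
Qed.

(** Positive flow limits make zero an interior point of [tradable] relative to
    the balanced vectors.  The factor [1 / (1 + \sum_l |f l| / F l)] suits all
    lines at once. *)
Lemma tradable_scaled (R : realType) (I L : nat)
    (ptdf : 'I_I -> 'I_L -> R) (F : 'I_L -> R) (d : 'rV[R]_I) :
  (forall l, 0 < F l) -> \sum_i d ord0 i = 0 ->
  exists2 t, 0 < t & tradable ptdf F (t *: d).
Proof.
move=> F_gt0 sd; pose f l := \sum_i ptdf i l * d ord0 i.
pose s := 1 + \sum_l `|f l| / F l.
have term_ge0 l : 0 <= `|f l| / F l by rewrite divr_ge0 ?(ltW (F_gt0 l)).
have s_gt0 : 0 < s by rewrite ltr_pwDl // sumr_ge0.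
exists s^-1; first by rewrite invr_gt0.
split=> [|l].
  rewrite (eq_bigr (fun j => s^-1 * d ord0 j)) => [|j _]; last by rewrite mxE.
  by rewrite -mulr_sumr sd mulr0.
rewrite (eq_bigr (fun j => s^-1 * (ptdf j l * d ord0 j))) => [|j _]; last first.
  by rewrite mxE mulrCA.
rewrite -mulr_sumr -/(f l) -ler_norml normrM ger0_norm ?invr_ge0 ?(ltW s_gt0) //.
rewrite mulrC ler_pdivrMr // mulrC -ler_pdivrMr //.
rewrite /s (bigD1 l) //= addrCA lerDl addr_ge0 //.
by apply: sumr_ge0 => k _; exact: term_ge0.
Qed.

Lemma tradable_both_signs (R : realType) (I L : nat)
    (ptdf : 'I_I -> 'I_L -> R) (F : 'I_L -> R) (i : 'I_I) :
  (1 < I)%N -> (forall l, 0 < F l) ->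
  (exists2 v, tradable ptdf F v & 0 < v ord0 i) /\
  (exists2 w, tradable ptdf F w & w ord0 i < 0).
Proof.
move=> I_gt1 F_gt0.
have [j ji] : exists j : 'I_I, j != i.
  have [<-|] := eqVneq (Ordinal (ltnW I_gt1)) i.
    by exists (Ordinal I_gt1).
  by exists (Ordinal (ltnW I_gt1)).
pose d : 'rV[R]_I := delta_mx ord0 i - delta_mx ord0 j.
have di : d ord0 i = 1.
  by rewrite !mxE !eqxx eq_sym (negPf ji) subr0.
have sd : \sum_k d ord0 k = 0.
  rewrite (eq_bigr (fun k => (k == i)%:R - (k == j)%:R)); last first.
    by move=> k _; rewrite !mxE eqxx.
  have sum1 (k0 : 'I_I) : \sum_k (k == k0)%:R = 1 :> R.
    by rewrite (bigD1 k0) //= eqxx big1 ?addr0 // => k /negPf ->.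
  by rewrite big_split sumrN /= !sum1 subrr.
split.
  have [t t_gt0 td] := tradable_scaled ptdf F_gt0 sd.
  by exists (t *: d) => //; rewrite mxE di mulr1.
have sNd : \sum_k (- d) ord0 k = 0.
  by under eq_bigr do rewrite mxE; rewrite sumrN sd oppr0.
have [t t_gt0 td] := tradable_scaled ptdf F_gt0 sNd.
by exists (t *: - d) => //; rewrite mxE [(- d) _ _]mxE di mulrN1 oppr_lt0.
Qed.

Lemma market_feasibleP (R : realType) (I L : nat) (a : R)
    (ptdf : 'I_I -> 'I_L -> R) (F : 'I_L -> R) (b lam : 'rV[R]_I) :
  market_feasible a ptdf F b lam <-> tradable ptdf F (b - a *: lam).
Proof.
have E j : (b - a *: lam) ord0 j = - a * lam ord0 j + b ord0 j.
  by rewrite !mxE; ring.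
have sumE : \sum_j (b - a *: lam) ord0 j
          = \sum_j (- a * lam ord0 j + b ord0 j) by apply: eq_bigr.
have flowE l : \sum_j ptdf j l * (b - a *: lam) ord0 j
             = \sum_j ptdf j l * (- a * lam ord0 j + b ord0 j).
  by apply: eq_bigr => j _; rewrite E.
rewrite /tradable /= sumE.
by split=> -[sb fb]; split=> // l; [rewrite flowE | rewrite -flowE].
Qed.

Lemma market_objectiveE (R : realType) (I : nat) (lam : 'rV[R]_I) :
  market_objective lam = I%:R^-1 * dot lam lam.
Proof. by congr (_ * _); apply: eq_bigr => j _; rewrite expr2. Qed.

(** [lam = a^-1 *: (b - q)] turns the market objective into a positive multiple
    of [dot (b - q) (b - q)], so a tradable [q] that satisfies the obtuse angle
    condition is the projection of [b], and [lam] is the only market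
    solution. *)
Lemma transaction_obtuse (R : realType) (I L : nat) (a : R)
    (ptdf : 'I_I -> 'I_L -> R) (F : 'I_L -> R) (b q : 'rV[R]_I) :
  0 < a -> tradable ptdf F q ->
  (forall v, tradable ptdf F v -> dot (b - q) (v - q) <= 0) ->
  forall i, transaction a ptdf F b i = q ord0 i.
Proof.
move=> a_gt0 q_tr obt i; have a_neq0 : a != 0 by rewrite gt_eqF.
have I_gt0 : 0 < I%:R :> R by rewrite ltr0n (leq_ltn_trans _ (ltn_ord i)).
pose lam := a^-1 *: (b - q).
have qE : b - a *: lam = q by rewrite scalerA divff // scale1r subKr.
have objE mu : dot (b - (b - a *: mu)) (b - (b - a *: mu)) = a ^+ 2 * dot mu mu.
  by rewrite subKr dotZr dotZl; ring.
have le_obj mu nu : market_objective mu <= market_objective nu <->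
    dot (b - (b - a *: mu)) (b - (b - a *: mu)) <=
    dot (b - (b - a *: nu)) (b - (b - a *: nu)).
  rewrite !objE !market_objectiveE ler_pM2l ?invr_gt0 //.
  by rewrite ler_pM2l ?exprn_gt0.
have priceE : price a ptdf F b = lam.
  apply: xget_unique.
    split=> [|mu /market_feasibleP mu_tr].
      by apply/market_feasibleP; rewrite qE.
    apply/le_obj; rewrite qE; have := obtuse_sqdist (obt _ mu_tr).
    by apply: le_trans; rewrite lerDl dot_ge0.
  move=> mu [/market_feasibleP mu_tr mu_min].
  have /mu_min/le_obj : market_feasible a ptdf F b lam.
    by apply/market_feasibleP; rewrite qE.
  rewrite qE => mu_le; have := le_trans (obtuse_sqdist (obt _ mu_tr)) mu_le.
  rewrite gerDl => /dot_le0_eq0/eqP; rewrite subr_eq0 => /eqP muE.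
  by rewrite /lam -muE subKr scalerA mulVf // scale1r.
by rewrite /transaction priceE !mxE mulrA mulNr divff // mulN1r; ring.
Qed.

(** The slice of [tradable] where prosumer [i] does not trade is closed, convex
    and contains zero, so [b] has a projection on it, to which the multiplier
    argument applies. *)
Lemma can_bid_out (R : realType) (I L : nat) (a : R)
    (ptdf : 'I_I -> 'I_L -> R) (F : 'I_L -> R) (b : 'rV[R]_I) (i : 'I_I) :
  (1 < I)%N -> (forall l, 0 < F l) -> 0 < a ->
  exists x, transaction a ptdf F (set_bid b i x) i = 0.
Proof.
move=> I_gt1 F_gt0 a_gt0.
pose C := tradable ptdf F `&` [set q | q ord0 i = 0].
have Ccl : closed C.
  apply: closedI; first exact: tradable_closed.
  apply: (proj1 (continuous_closedP _) (@coord_continuous R 1 I ord0 i)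
            [set x | x = 0]).
  exact: closed_eq.
have Cconv : segment_closed C.
  move=> u v t t01 [u_tr ui0] [v_tr vi0]; split.
    exact: tradable_segment_closed.
  by rewrite /= !mxE ui0 vi0 !mulr0 addr0.
have C0 : C !=set0.
  exists 0; split; last by rewrite /= mxE.
  split=> [|l]; first by rewrite big1 // => j _; rewrite mxE.
  rewrite big1 => [|j _]; last by rewrite mxE mulr0.
  by rewrite oppr_le0 ltW.
have [q Cq qmin] := closest_point_exists b Ccl C0.
have obt := closest_point_obtuse Cconv Cq qmin; have [q_tr qi0] := Cq.
have [pos neg] := tradable_both_signs ptdf i I_gt1 F_gt0.
have [x xP] := zero_coordinate_multiplier (@tradable_segment_closed _ _ _ ptdf F)
  pos neg qi0 (fun u u_tr ui0 => obt u (conj u_tr ui0)).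
by exists x; rewrite (transaction_obtuse a_gt0 q_tr xP).
Qed.

(** * Comparison with individual decision-making *)

Theorem proposition4 (R : realType) (I K L : nat) (B : finType)
    (src dst : 'I_L -> B) (beta : 'I_L -> R) (bus : 'I_I -> B)
    (ptdf : 'I_I -> 'I_L -> R) (F : 'I_L -> R)
    (a : R) (c : 'I_I -> 'I_K -> R) (D : 'I_I -> R)
    (hI : (2 <= I)%N) (hK : (1 <= K)%N)
    (hnet : simple_network src dst)
    (hbeta : forall l, 0 < beta l)
    (hptdf : is_ptdf src dst beta bus ptdf)
    (hF : forall l, 0 < F l)
    (ha : 0 < a)
    (hc : forall i k, 0 < c i k)
    (b : 'rV[R]_I) (p : 'I_I -> 'rV[R]_K)
    (hGNE : is_GNE a c D ptdf F b p) :
  forall i, prosumer_cost a c ptdf F i (p i) b <= individual_cost (c i) (D i).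
Proof.
move=> i; have [x q0] := can_bid_out ptdf b i hI hF ha.
have [_ /(_ i)[_ opt]] := hGNE.
apply: lb_le_inf.
  (* Some [p] meets the demand: put all of it on the first resource. *)
  pose k0 := Ordinal hK.
  exists (adjustment_cost (c i) (D i *: delta_mx ord0 k0)).
  exists (D i *: delta_mx ord0 k0) => //=.
  rewrite (bigD1 k0) //= !mxE !eqxx mulr1 big1 ?addr0 // => k /negPf kk0.
  by rewrite !mxE kk0 mulr0.
move=> _ [pi' /= sum_pi' <-].
have := opt pi' x; rewrite /prosumer_feasible q0 addr0 => /(_ sum_pi').
by rewrite [in leRHS]/prosumer_cost q0 !mulr0 maxxx addr0.
Qed.
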